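(* Let $A$ be a regular system of divisors, $S$ a nonempty subset of $\mathbb N$, and $n\in\mathbb N$. Write $\Phi_{A,S,n}(x)=\sum_{j\ge0}a_{A,S,n}(j)x^j$ (so $a_{A,S,n}(j)=0$ for $j>\varphi_{A,S}(n)$). Then for every positive integer $k$, \[ a_{A,S,n}(k)=(-1)^{\varrho_S(n)}\sum_{\substack{j_1,\dots,j_k\ge0\\ j_1+2j_2+\cdots+kj_k=k}}\ \prod_{d=1}^k(-1)^{j_d}\binom{\mu_{A,S}(n/d)}{j_d}, \] with the convention $\mu_{A,S}(t)=0$ if $t$ is not an integer, and where $\binom{m}{j}=m(m-1)\cdots(m-j+1)/j!$ for $m\in\mathbb Z$.
   Context: A regular system of divisors is a family $A=(A(n))_{n\in\mathbb N}$, where each $A(n)$ is a set of positive divisors of $n$, such that: (i) $A(1)=\{1\}$ and $A(mn)=\{de: d\in A(m), e\in A(n)\}$ whenever $\gcd(m,n)=1$; (ii) for every prime power $p^a$ ($a\ge1$) there is a divisor $t=t_A(p^a)$ of $a$ such that $A(p^{it})=\{1,p^t,\dots,p^{it}\}$ for every $0\le i\le a/t$. $\mu_A$ is the inverse of the constant function $1$ under the $A$-convolution $(f*_Ag)(n)=\sum_{d\in A(n)}f(d)g(n/d)$. For $j\in\mathbb Z$, $(j,n)_A=\max\{d\in\mathbb N: d\mid j,\ d\in A(n)\}$; $\zeta_n=e^{2\pi i/n}$. For $S$ with characteristic function $\varrho_S$, $\mu_{A,S}(n)=\sum_{d\in A(n)}\mu_A(d)\varrho_S(n/d)$ and $\Phi_{A,S,n}(x)=\prod_{1\le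 j\le n,\ (j,n)_A\in S}(x-\zeta_n^j)$, of degree $\varphi_{A,S}(n)=\#\{1\le j\le n:(j,n)_A\in S\}$.
   Formalization: The convention is changed: μ_{A,S}(n/d) is taken as 0 whenever d is not in A(n), not only when n/d is not an integer; the literal formula fails for unitary divisors with S={1}, n=4, k=2 (it gives 2 instead of 1). *)

(* Defs.v *)
From HB Require Import structures.
From mathcomp Require Export all_boot all_order all_algebra.
From mathcomp Require Export all_classical all_reals all_analysis.
From mathcomp Require Export complex.

Set Implicit Arguments.
Unset Strict Implicit.
Unset Printing Implicit Defensive.

Import Order.TTheory GRing.Theory Num.Theory.

Local Open Scope classical_set_scope.
Local Open Scope ring_scope.

(* Families, arithmetical functions and sets of positive integers are indexed
   by nat; their values at 0 are never used. *)
Record regular_system (A : nat -> set nat) : Prop := RegularSystem {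
  regular_dvd : forall n d, (0 < n)%N -> A n d -> (d %| n)%N;
  regular_1 : A 1%N = [set 1%N];
  regular_mul : forall m n, (0 < m)%N -> (0 < n)%N -> coprime m n ->
    A (m * n)%N = [set x | exists d e, [/\ A m d, A n e & x = (d * e)%N]];
  regular_prime_power : forall p a, prime p -> (0 < a)%N ->
    exists2 t, (t %| a)%N &
      forall i, (i <= a %/ t)%N ->
        A (p ^ (i * t))%N = [set x | exists2 l, (l <= i)%N & x = (p ^ (l * t))%N]
}.

Definition Aconv (A : nat -> set nat) (f g : nat -> int) (n : nat) : int :=
  \sum_(d <- divisors n | d \in A n) f d * g (n %/ d)%N.

Definition is_Ainverse (A : nat -> set nat) (f g : nat -> int) : Prop :=
  forall n, (0 < n)%N ->
    Aconv A f g n = (n == 1%N)%:R /\ Aconv A g f n = (n == 1%N)%:R.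

(* The condition mu 0 = 0 only makes the inverse unique as a function on nat. *)
Definition mobiusA (A : nat -> set nat) : nat -> int :=
  xget (fun=> 0) [set mu : nat -> int | mu 0%N = 0 /\ is_Ainverse A (fun=> 1) mu].

Definition rho (S : set nat) (n : nat) : int := (n \in S)%:R.

Definition mobiusAS (A : nat -> set nat) (S : set nat) (n : nat) : int :=
  \sum_(d <- divisors n | d \in A n) mobiusA A d * rho S (n %/ d)%N.

(* mu_{A,S}(n/d), extended by 0 to those d that do not belong to A(n), in
   particular to those for which n/d is not an integer.
   Extending by 0 only when d does not divide n would be wrong:
   for the unitary system (d in A(n) iff d | n and gcd(d, n/d) = 1), S = {1} and
   n = 4, the polynomial PhiAS below is 1 + x + x^2 + x^3, but d = 2, which
   divides 4 and is not in A(4) = {1, 4}, would contribute a spurious factor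
   (1 - x^2)^-1 since mu_{A,S}(2) = -1, and give 2 as coefficient of x^2. *)
Definition mobiusAS_quo (A : nat -> set nat) (S : set nat) (n d : nat) : int :=
  if d \in A n then mobiusAS A S (n %/ d)%N else 0.

Definition gcdA (A : nat -> set nat) (j : int) (n : nat) : nat :=
  \max_(d <- divisors n | (d%:Z %| j)%Z && (d \in A n)) d.

Definition zeta (R : realType) (n : nat) : R[i] :=
  Complex (cos (2 * pi / n%:R)) (sin (2 * pi / n%:R)).

Definition PhiAS (R : realType) (A : nat -> set nat) (S : set nat) (n : nat) :
    {poly R[i]} :=
  \prod_(1 <= j < n.+1 | gcdA A j%:Z n \in S) ('X - (zeta R n ^+ j)%:P).

Definition gbinom (F : numFieldType) (m : int) (j : nat) : F :=
  (\prod_(i < j) (m%:~R - i%:R)) / j`!%:R.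

(* Main.v *)
Require Import Defs.
From mathcomp Require Import ring lra.

Set Implicit Arguments.
Unset Strict Implicit.
Unset Printing Implicit Defensive.

Import Order.TTheory GRing.Theory Num.Theory.

Local Open Scope classical_set_scope.
Local Open Scope ring_scope.

(** For fixed [n] there are numbers [t p] such that, for every [m] in [A n],
    [A m] consists of the divisors of [m] whose valuation at each prime [p] is
    a multiple of [t p].  Hence the [A]-convolution is commutative and
    associative, and Moebius inversion gives
    [rho S (gcdA A j n) = \sum_(d in A n, d | j) mobiusAS A S d].  Taking
    products of the ['X - zeta ^ j] with these exponents yields
    [PhiAS = \prod_(d in A n) ('X^(n / d) - 1) ^ mobiusAS A S d], and the signs
    of the factors multiply to [(-1) ^ rho S n].  To read off the coefficient
    of ['X^k], compute in the quotient by ['X^(k + 1)], where ['X] is nilpotent,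
    so that [1 - 'X^d] has all its integer powers and these are given by finite
    binomial series. *)

Lemma coprime_pfactor_ind (P : nat -> Prop) :
  P 1%N ->
  (forall p a m, prime p -> (0 < a)%N -> (0 < m)%N -> coprime (p ^ a) m ->
    P m -> P (p ^ a * m)%N) ->
  forall m, (0 < m)%N -> P m.
Proof.
move=> P1 PM; elim/ltn_ind=> m IHm m_gt0.
have [m_le1|m_gt1] := leqP m 1; first by rewrite (@anti_leq m 1) ?m_le1.
have pr_p := pdiv_prime m_gt1; set p := pdiv m in pr_p.
have logn_pm_gt0 : (0 < logn p m)%N.
  by rewrite logn_gt0 mem_primes pr_p m_gt0 pdiv_dvd.
have [m' co_p_m' mE] := pfactor_coprime pr_p m_gt0.
have m'_gt0 : (0 < m')%N by move: m_gt0; rewrite mE muln_gt0 => /andP[].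
rewrite mE mulnC; apply: PM; rewrite ?coprimeXl //; apply: IHm => //.
by rewrite [ltnRHS]mE ltn_Pmulr // -(exp1n (logn p m)) ltn_exp2r ?prime_gt1.
Qed.

Lemma dvdn_mulP d m n : (0 < d)%N ->
  reflect (exists d1 d2, [/\ (d1 %| m)%N, (d2 %| n)%N & d = (d1 * d2)%N])
          (d %| m * n)%N.
Proof.
move=> d_gt0; apply: (iffP idP) => [d_dvd|[d1 [d2 [? ? ->]]]]; last first.
  exact: dvdn_mul.
set g := gcdn d m; have g_dvd_d : (g %| d)%N := dvdn_gcdl d m.
have g_dvd_m : (g %| m)%N := dvdn_gcdr d m.
have g_gt0 : (0 < g)%N by rewrite gcdn_gt0 d_gt0.
have co_quotients : coprime (d %/ g) (m %/ g).
  by rewrite /coprime -(eqn_pmul2r g_gt0) muln_gcdl !divnK ?mul1n.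
exists g, (d %/ g)%N; split=> //; last by rewrite mulnC divnK.
by rewrite -(Gauss_dvdr _ co_quotients) -(dvdn_pmul2r g_gt0) mulnAC !divnK.
Qed.

Section ExponentMultiples.
Local Open Scope nat_scope.
Variable t : nat -> nat.

Definition exp_multiple m : Prop := forall p, t p %| logn p m.

Lemma exp_multipleM m n : 0 < m -> 0 < n -> exp_multiple m ->
  exp_multiple (m * n) <-> exp_multiple n.
Proof.
by move=> m_gt0 n_gt0 tm; split=> tn p; have := tn p; rewrite lognM ?dvdn_addr.
Qed.

Lemma exp_multiple_div d n : d %| n -> exp_multiple d -> exp_multiple n ->
  exp_multiple (n %/ d).
Proof. by move=> d_dvd td tn p; rewrite logn_div ?dvdn_sub. Qed.

Lemma exp_multiple_lcm m n : 0 < m -> 0 < n ->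
  exp_multiple m -> exp_multiple n -> exp_multiple (lcmn m n).
Proof. by move=> m_gt0 n_gt0 tm tn p; rewrite logn_lcm // /maxn; case: ifP. Qed.

Lemma exp_multiple_coprimeM m n : 0 < m -> 0 < n -> coprime m n ->
  exp_multiple (m * n) <-> exp_multiple m /\ exp_multiple n.
Proof.
move=> m_gt0 n_gt0 co_mn; split=> [tmn|[tm tn]]; last exact/exp_multipleM.
suff logn0 p : logn p m = 0 \/ logn p n = 0.
  by split=> p; have := tmn p; rewrite lognM //;
    case: (logn0 p) => -> //; rewrite addn0.
have [|p_ndvd] := boolP (p %| m); last first.
  by left; rewrite lognE (negPf p_ndvd) !andbF.
by move=> p_dvd; right; apply: logn_coprime; apply: coprime_dvdl co_mn.
Qed.

Lemma exp_multiple_pfactor p a : prime p -> exp_multiple (p ^ a) <-> t p %| a.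
Proof.
move=> pr_p; split=> [/(_ p)|ta q]; first by rewrite pfactorK.
rewrite lognX logn_prime //; case: eqP => [->|_]; last by rewrite muln0.
by rewrite muln1.
Qed.

Definition exp_divisors m : set nat := [set d | d %| m /\ exp_multiple d].

Lemma exp_divisorsM m n : 0 < m -> 0 < n -> coprime m n ->
  [set x | exists d e, [/\ exp_divisors m d, exp_divisors n e & x = d * e]] =
  exp_divisors (m * n).
Proof.
move=> m_gt0 n_gt0 co_mn.
have exp_multiple_split d e : d %| m -> e %| n ->
    exp_multiple (d * e) <-> exp_multiple d /\ exp_multiple e.
  move=> d_dvd e_dvd; apply: exp_multiple_coprimeM.
  - exact: dvdn_gt0 d_dvd.
  - exact: dvdn_gt0 e_dvd.
  - exact: coprime_dvdl d_dvd (coprime_dvdr e_dvd co_mn).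
apply/seteqP; split=> [_ [d [e [[d_dvd td] [e_dvd te] ->]]]|x [x_dvd tx]].
  by split; [exact: dvdn_mul | exact/exp_multiple_split].
have x_gt0 : 0 < x by apply: dvdn_gt0 x_dvd; rewrite muln_gt0 m_gt0.
have /(dvdn_mulP _ _ x_gt0)[d [e [d_dvd e_dvd xE]]] := x_dvd.
have [td te] : exp_multiple d /\ exp_multiple e.
  by apply/exp_multiple_split; rewrite -?xE.
by exists d, e.
Qed.

Lemma exp_divisors_pfactor p i : prime p -> 0 < t p ->
  exp_divisors (p ^ (i * t p)) =
  [set x | exists2 l, l <= i & x = p ^ (l * t p)].
Proof.
move=> pr_p t_gt0; apply/seteqP; split=> [x []|].
  move=> /(dvdn_pfactor _ _ pr_p)[b b_le ->].
  move/(exp_multiple_pfactor _ pr_p)/dvdnP=> [l bE].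
  exists l; last by rewrite bE.
  by rewrite -(leq_pmul2r t_gt0) -bE.
move=> _ [l l_le ->]; split; first by rewrite dvdn_exp2l // leq_mul2r l_le orbT.
by apply/exp_multiple_pfactor; rewrite // dvdn_mull.
Qed.

End ExponentMultiples.

Section RegularSystem.
Local Open Scope nat_scope.
Variables (A : nat -> set nat) (hA : regular_system A).

Lemma regular_prime_exponent n p : exists t, t %| logn p n /\
  (forall i, 0 < logn p n -> i * t <= logn p n ->
     A (p ^ (i * t)) = [set x | exists2 l, l <= i & x = p ^ (l * t)]).
Proof.
have [->|a_gt0] := posnP (logn p n); first by exists 1.
have pr_p : prime p by move: a_gt0; rewrite lognE; case: prime.
have [t t_dvd tP] := regular_prime_power hA pr_p a_gt0.
exists t; split=> // i _ le_it; apply: tP.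
by rewrite leq_divRL // (dvdn_gt0 a_gt0).
Qed.

Lemma regular_exp_divisors n : 0 < n -> exists t, exp_multiple t n /\
  forall m, m %| n -> exp_multiple t m -> A m = exp_divisors t m.
Proof.
move=> n_gt0; have /choice[t tP] p := regular_prime_exponent n p.
have tn : exp_multiple t n by move=> p; have [] := tP p.
exists t; split=> // m m_dvd.
have m_gt0 := dvdn_gt0 n_gt0 m_dvd; move: m m_gt0 m_dvd.
apply: coprime_pfactor_ind => [_ _|p a m pr_p a_gt0 m_gt0 co_pm IHm pm_dvd].
  rewrite (regular_1 hA); apply/seteqP; split=> d /=; last first.
    by case; rewrite dvdn1 => /eqP.
  by move=> ->; split=> // p; rewrite logn1.
have pa_gt0 : 0 < p ^ a by rewrite expn_gt0 prime_gt0.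
case/exp_multiple_coprimeM=> // /exp_multiple_pfactor-/(_ pr_p)/dvdnP[i aE] tm.
rewrite (regular_mul hA) // -exp_divisorsM //.
have le_a : a <= logn p n.
  by rewrite -pfactor_dvdn // (dvdn_trans _ pm_dvd) ?dvdn_mulr.
have t_gt0 : 0 < t p by move: a_gt0; rewrite aE muln_gt0 => /andP[].
have -> : A (p ^ a) = exp_divisors t (p ^ a).
  rewrite aE exp_divisors_pfactor //; apply: (tP p).2; rewrite -?aE //.
  exact: leq_trans le_a.
by rewrite IHm // (dvdn_trans _ pm_dvd) ?dvdn_mull.
Qed.

Lemma regular_gt0 n d : 0 < n -> A n d -> 0 < d.
Proof. by move=> n_gt0 /(regular_dvd hA n_gt0); apply: dvdn_gt0. Qed.

Lemma regular_self n : 0 < n -> A n n.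
Proof. by case/regular_exp_divisors=> t [tn A_eq]; rewrite A_eq. Qed.

Lemma regular_divn n d : 0 < n -> A n d -> A n (n %/ d).
Proof.
case/regular_exp_divisors=> t [tn A_eq]; rewrite A_eq // => -[d_dvd td].
by split; [exact: dvdn_div | exact: exp_multiple_div].
Qed.

Lemma regular_one n : 0 < n -> A n 1.
Proof.
move=> n_gt0; have := regular_divn n_gt0 (regular_self n_gt0).
by rewrite divnn n_gt0.
Qed.

Lemma regular_lcmn n d e : 0 < n -> A n d -> A n e -> A n (lcmn d e).
Proof.
move=> n_gt0; have [t [tn A_eq]] := regular_exp_divisors n_gt0.
rewrite A_eq // => -[d_dvd td] [e_dvd te].
split; first by rewrite dvdn_lcm d_dvd.
by apply: exp_multiple_lcm; rewrite ?(dvdn_gt0 n_gt0).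
Qed.

Lemma regular_subP n d e : 0 < n -> A n d -> A d e <-> A n e /\ e %| d.
Proof.
move=> n_gt0; have [t [tn A_eq]] := regular_exp_divisors n_gt0.
rewrite (A_eq n) // => -[d_dvd td]; rewrite (A_eq d) //.
split=> [[e_dvd te]|[[_ te] e_dvd]]; split=> //.
by split=> //; apply: dvdn_trans d_dvd.
Qed.

Lemma regular_quoP n d e : 0 < n -> A n d -> A (n %/ d) e <-> A n (d * e).
Proof.
move=> n_gt0; have [t [tn A_eq]] := regular_exp_divisors n_gt0.
rewrite (A_eq n) // => -[d_dvd td].
have d_gt0 := dvdn_gt0 n_gt0 d_dvd.
rewrite (A_eq _ (dvdn_div d_dvd)) /exp_divisors /=; last first.
  exact: exp_multiple_div.
rewrite dvdn_divRL // mulnC.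
have e_gt0 (de_dvd : d * e %| n) : 0 < e.
  by have := dvdn_gt0 n_gt0 de_dvd; rewrite muln_gt0 => /andP[].
split=> -[de_dvd te]; split=> //.
  exact/(exp_multipleM d_gt0 (e_gt0 de_dvd)).
exact/(exp_multipleM d_gt0 (e_gt0 de_dvd) td).
Qed.

End RegularSystem.

Arguments regular_subP {A} hA {n d e}.
Arguments regular_quoP {A} hA {n d e}.

Definition regular_divisors (A : nat -> set nat) (n : nat) : seq nat :=
  [seq d <- divisors n | d \in A n].

Section RegularDivisors.
Variables (A : nat -> set nat) (hA : regular_system A).

Lemma mem_regular_divisors n d : (0 < n)%N ->
  (d \in regular_divisors A n) = (d \in A n).
Proof.
move=> n_gt0; rewrite mem_filter -dvdn_divisors //; apply: andb_idr.
by move=> /set_mem; apply: (regular_dvd hA).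
Qed.

Lemma regular_divisorsP n d : (0 < n)%N ->
  reflect (A n d) (d \in regular_divisors A n).
Proof.
move=> n_gt0; rewrite mem_regular_divisors //.
by apply: (iffP idP) => [/set_mem|/mem_set].
Qed.
Arguments regular_divisorsP {n d}.

Lemma regular_divisors_uniq n : uniq (regular_divisors A n).
Proof. exact/filter_uniq/divisors_uniq. Qed.

Lemma perm_regular_divisors_divn n : (0 < n)%N ->
  perm_eq (regular_divisors A n) [seq (n %/ d)%N | d <- regular_divisors A n].
Proof.
move=> n_gt0; set rd := regular_divisors A n.
have divn_divnK d : d \in rd -> (n %/ (n %/ d))%N = d.
  move=> /(regular_divisorsP n_gt0)/(regular_dvd hA n_gt0) d_dvd.
  by rewrite divnA // mulKn.
have mem_divn d : d \in rd -> (n %/ d)%N \in rd.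
  move=> /(regular_divisorsP n_gt0) Ad.
  exact/(regular_divisorsP n_gt0)/(regular_divn hA).
apply: uniq_perm; first exact: regular_divisors_uniq.
  rewrite map_inj_in_uniq ?regular_divisors_uniq // => d e d_in e_in.
  by move/(congr1 (divn n)); rewrite !divn_divnK.
move=> d; apply/idP/mapP=> [d_in|[e e_in ->]]; last exact: mem_divn.
by exists (n %/ d)%N; rewrite ?mem_divn ?divn_divnK.
Qed.

Lemma perm_regular_divisors_sub n m : (0 < n)%N -> A n m ->
  perm_eq (regular_divisors A m) [seq d <- regular_divisors A n | (d %| m)%N].
Proof.
move=> n_gt0 Am; have m_gt0 := regular_gt0 hA n_gt0 Am.
apply: uniq_perm.
- exact: regular_divisors_uniq.
- exact/filter_uniq/regular_divisors_uniq.
move=> d; rewrite [RHS]mem_filter [RHS]andbC.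
apply/idP/andP=> [/(regular_divisorsP m_gt0)|].
  move=> /(regular_subP hA n_gt0 Am)[Ad d_dvd].
  by split=> //; apply/(regular_divisorsP n_gt0).
case=> /(regular_divisorsP n_gt0) Ad d_dvd.
exact/(regular_divisorsP m_gt0)/(regular_subP hA n_gt0 Am).
Qed.

Lemma perm_regular_divisors_quo n m : (0 < n)%N -> A n m ->
  perm_eq [seq (m * d)%N | d <- regular_divisors A (n %/ m)]
          [seq d <- regular_divisors A n | (m %| d)%N].
Proof.
move=> n_gt0 Am; have m_gt0 := regular_gt0 hA n_gt0 Am.
have q_gt0 : (0 < n %/ m)%N.
  by rewrite divn_gt0 // dvdn_leq // (regular_dvd hA).
apply: uniq_perm.
- rewrite map_inj_uniq ?regular_divisors_uniq // => d e /eqP.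
  by rewrite eqn_pmul2l // => /eqP.
- exact/filter_uniq/regular_divisors_uniq.
move=> d; rewrite [RHS]mem_filter; apply/mapP/andP=> [[e e_in ->]|[m_dvd d_in]].
  split; first exact: dvdn_mulr.
  apply/(regular_divisorsP n_gt0)/(regular_quoP hA n_gt0 Am).
  exact/(regular_divisorsP q_gt0).
exists (d %/ m)%N; last by rewrite mulnC divnK.
apply/(regular_divisorsP q_gt0)/(regular_quoP hA n_gt0 Am).
by rewrite mulnC divnK //; apply/regular_divisorsP.
Qed.

End RegularDivisors.

Arguments regular_divisorsP {A} hA {n d}.

Lemma ltn_recursion (T : Type) (step : (nat -> T) -> nat -> T) (x0 : T) :
  (forall n f g, (forall m, (m < n)%N -> f m = g m) -> step f n = step g n) ->
  exists f, forall n, f n = step f n.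
Proof.
move=> step_lt; pose approx k := iter k step (fun=> x0).
have approx_stable k : forall n, (n < k)%N -> approx k n = approx n.+1 n.
  elim/ltn_ind: k => -[//|k] IHk n; rewrite ltnS => n_le.
  apply: (step_lt n (approx k) (approx n)) => m m_lt.
  by rewrite (IHk k) ?(IHk n) // (leq_trans m_lt).
exists (fun n => approx n.+1 n) => n; rewrite {1}/approx /=.
by apply: step_lt => m m_lt; apply: approx_stable.
Qed.

Section Convolution.
Variables (A : nat -> set nat) (hA : regular_system A).
Implicit Types (f g h : nat -> int) (n : nat).

Lemma AconvE f g n :
  Aconv A f g n = \sum_(d <- regular_divisors A n) f d * g (n %/ d)%N.
Proof. by rewrite /Aconv -big_filter. Qed.

Lemma eq_Aconvl f f' g n : (0 < n)%N -> {in A n, f =1 f'} ->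
  Aconv A f g n = Aconv A f' g n.
Proof. by move=> n_gt0 ff'; apply: eq_bigr => d /ff' ->. Qed.

Lemma AconvC f g n : (0 < n)%N -> Aconv A f g n = Aconv A g f n.
Proof.
move=> n_gt0; rewrite !AconvE.
rewrite (perm_big _ (perm_regular_divisors_divn hA n_gt0)) big_map.
apply: eq_big_seq => d /(regular_divisorsP hA n_gt0) Ad.
by rewrite mulrC divnA ?(regular_dvd hA) // mulKn.
Qed.

Lemma AconvA f g h n : (0 < n)%N ->
  Aconv A f (Aconv A g h) n = Aconv A (Aconv A f g) h n.
Proof.
move=> n_gt0.
transitivity (\sum_(d <- regular_divisors A n)
    \sum_(m <- regular_divisors A n | (d %| m)%N)
      f d * (g (m %/ d)%N * h (n %/ m)%N)).
  rewrite AconvE; apply: eq_big_seq => d /(regular_divisorsP hA n_gt0) Ad.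
  have d_gt0 := regular_gt0 hA n_gt0 Ad.
  rewrite AconvE mulr_sumr -[RHS]big_filter.
  rewrite -(perm_big _ (perm_regular_divisors_quo hA n_gt0 Ad)) big_map.
  by apply: eq_bigr => e _; rewrite mulKn // divnMA.
rewrite (exchange_big_dep xpredT) //= AconvE.
apply: eq_big_seq => m /(regular_divisorsP hA n_gt0) Am.
rewrite AconvE (perm_big _ (perm_regular_divisors_sub hA n_gt0 Am)) big_filter.
by rewrite mulr_suml; apply: eq_bigr => d _; rewrite mulrA.
Qed.

Lemma Aconv1l f n : (0 < n)%N -> Aconv A (fun d => (d == 1%N)%:R) f n = f n.
Proof.
move=> n_gt0; have /(regular_divisorsP hA n_gt0) oneA := regular_one hA n_gt0.
rewrite AconvE (bigD1_seq _ oneA) ?regular_divisors_uniq //= divn1 mul1r.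
by rewrite big1 ?addr0 // => d /negPf ->; rewrite mul0r.
Qed.

Lemma Aconv_right_inverse f : f 1%N \is a GRing.unit ->
  exists g, g 0%N = 0 /\ forall n, (0 < n)%N -> Aconv A f g n = (n == 1%N)%:R.
Proof.
move=> f1_unit.
pose step g n := if n == 0%N then 0 else
  (f 1%N)^-1 * ((n == 1%N)%:R
    - \sum_(d <- regular_divisors A n | d != 1%N) f d * g (n %/ d)%N).
have [n g g' gg'|g gE] := @ltn_recursion _ step 0.
  rewrite /step; case: eqP => // /eqP; rewrite -lt0n => n_gt0.
  congr (_ * (_ - _)).
  rewrite big_seq_cond [RHS]big_seq_cond.
  apply: eq_bigr => d /andP[/(regular_divisorsP hA n_gt0) Ad d_neq1].
  by rewrite gg' // ltn_Pdiv // ltn_neqAle eq_sym d_neq1 (regular_gt0 hA n_gt0).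
exists g; split=> [|n n_gt0]; first by rewrite gE.
have /(regular_divisorsP hA n_gt0) oneA := regular_one hA n_gt0.
rewrite AconvE (bigD1_seq _ oneA) ?regular_divisors_uniq //= divn1 gE.
by rewrite /step gtn_eqF // mulVKr // subrK.
Qed.

Lemma mobiusAP : is_Ainverse A (fun=> 1) (mobiusA A).
Proof.
suff [] : mobiusA A 0%N = 0 /\ is_Ainverse A (fun=> 1) (mobiusA A) by [].
have [mu [mu0 mu_inv]] := @Aconv_right_inverse (fun=> 1) (unitr1 _).
apply: (@xgetPex _ _ [set mu | mu 0%N = 0 /\ is_Ainverse A (fun=> 1) mu]).
exists mu; split=> // n n_gt0.
by rewrite [Aconv A mu _ n]AconvC // mu_inv.
Qed.

Lemma sum_mobiusAS (S : set nat) n : (0 < n)%N ->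
  \sum_(d <- regular_divisors A n) mobiusAS A S d = rho S n.
Proof.
move=> n_gt0.
transitivity (Aconv A (fun=> 1) (Aconv A (mobiusA A) (rho S)) n).
  by rewrite AconvC // AconvE; apply: eq_bigr => d _; rewrite mulr1.
rewrite AconvA // -[RHS]Aconv1l //; apply: eq_Aconvl => // d /set_mem Ad.
exact: (mobiusAP (regular_gt0 hA n_gt0 Ad)).1.
Qed.

Lemma gcdAP (j : int) n : (0 < n)%N ->
  [/\ A n (gcdA A j n), ((gcdA A j n)%:Z %| j)%Z &
    forall d, A n d -> (d%:Z %| j)%Z -> (d %| gcdA A j n)%N].
Proof.
move=> n_gt0; set g := gcdA _ _ _.
have g_max d : A n d -> (d%:Z %| j)%Z -> (d <= g)%N.
  move=> Ad dj; apply: leq_bigmax_seq => /=; last by rewrite dj inE.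
  by rewrite -dvdn_divisors // (regular_dvd hA).
have [Ag gj] : A n g /\ (g%:Z %| j)%Z.
  have [g0|//] : g = 0%N \/ A n g /\ (g%:Z %| j)%Z.
    rewrite /g /gcdA; elim/big_ind: _ => [|d e|d /andP[dj /set_mem Ad]].
    - by left.
    - by rewrite /maxn; case: ifP.
    - by right.
  by have := g_max 1%N (regular_one hA n_gt0) (dvd1z j); rewrite g0.
split=> // d Ad dj; have g_gt0 := regular_gt0 hA n_gt0 Ag.
have lcm_le : (lcmn d g <= g)%N.
  apply: g_max; first exact: (regular_lcmn hA).
  by rewrite dvdzE /= dvdn_lcm -!(dvdzE _%:Z) dj.
suff <- : lcmn d g = g by apply: dvdn_lcml.
apply/anti_leq; rewrite lcm_le dvdn_leq ?dvdn_lcmr // lcmn_gt0 g_gt0.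
by rewrite (regular_gt0 hA n_gt0 Ad).
Qed.

Lemma rho_gcdA (S : set nat) (j : int) n : (0 < n)%N ->
  rho S (gcdA A j n) =
  \sum_(d <- regular_divisors A n | (d%:Z %| j)%Z) mobiusAS A S d.
Proof.
move=> n_gt0; have [Ag gj g_max] := gcdAP j n_gt0.
rewrite -sum_mobiusAS; last exact: (regular_gt0 hA n_gt0 Ag).
rewrite (perm_big _ (perm_regular_divisors_sub hA n_gt0 Ag)) big_filter.
rewrite big_seq_cond [RHS]big_seq_cond; apply: eq_bigl => d.
apply: andb_id2l => /(regular_divisorsP hA n_gt0) Ad.
apply/idP/idP=> [d_dvd|]; last exact: g_max.
by apply: dvdz_trans gj; rewrite dvdzE.
Qed.

End Convolution.

Section IntegerPowers.
Variables (B : comUnitRingType) (I : Type) (r : seq I) (P : pred I).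

Lemma prodr_exprz_sum (x : B) (e : I -> int) : x \is a GRing.unit ->
  \prod_(i <- r | P i) x ^ e i = x ^ (\sum_(i <- r | P i) e i).
Proof. by move=> x_unit; rewrite (big_morph _ (exprzDr x_unit) (expr0z x)). Qed.

Lemma exprz_prod (u : I -> B) (z : int) :
  (forall i, P i -> u i \is a GRing.unit) ->
  (\prod_(i <- r | P i) u i) ^ z = \prod_(i <- r | P i) u i ^ z.
Proof.
move=> u_unit; elim: r => [|i s IHs]; first by rewrite !big_nil exp1rz.
rewrite !big_cons; case: ifP => // Pi; rewrite -IHs exprMz_comm ?u_unit //.
- exact: rpred_prod.
- exact: mulrC.
Qed.

End IntegerPowers.

Lemma prod_gcdA (A : nat -> set nat) (S : set nat) (n : nat)
    (B : comUnitRingType) (I : Type) (r : seq I) (j : I -> int) (u : I -> B) :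
  regular_system A -> (0 < n)%N -> (forall i, u i \is a GRing.unit) ->
  \prod_(i <- r | gcdA A (j i) n \in S) u i =
  \prod_(d <- regular_divisors A n)
    (\prod_(i <- r | (d%:Z %| j i)%Z) u i) ^ mobiusAS A S d.
Proof.
move=> hA n_gt0 u_unit; rewrite big_mkcond.
under [RHS]eq_bigr do rewrite exprz_prod //.
rewrite (exchange_big_dep xpredT) //=; apply: eq_bigr => i _.
rewrite prodr_exprz_sum // -rho_gcdA // /rho.
by case: (_ \in S); rewrite ?expr1z ?expr0z.
Qed.

Lemma perm_multiples_iota n d : (0 < d)%N ->
  perm_eq [seq j <- index_iota 1 n.+1 | (d %| j)%N]
          [seq (d * i)%N | i <- index_iota 1 (n %/ d).+1].
Proof.
move=> d_gt0; apply: uniq_perm; first exact/filter_uniq/iota_uniq.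
  rewrite map_inj_uniq ?iota_uniq // => i j /eqP.
  by rewrite eqn_pmul2l // => /eqP.
move=> j; rewrite mem_filter mem_index_iota ltnS.
apply/and3P/mapP=> [|[i i_in ->]].
  case=> /dvdnP[i ->] id_gt0 id_le; exists i; last exact: mulnC.
  rewrite mem_index_iota ltnS leq_divRL // id_le andbT.
  by move: id_gt0; rewrite muln_gt0 => /andP[].
move: i_in; rewrite mem_index_iota ltnS leq_divRL // mulnC.
by move=> /andP[i_gt0 id_le]; split; rewrite ?dvdn_mulr // muln_gt0 d_gt0.
Qed.

Lemma factor_Xn_sub_1_multiples (F : fieldType) n d (z : F) :
  n.-primitive_root z -> (d %| n)%N ->
  \prod_(1 <= j < n.+1 | (d %| j)%N) ('X - (z ^+ j)%:P) = 'X^(n %/ d) - 1.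
Proof.
move=> prim_z d_dvd; have n_gt0 := prim_order_gt0 prim_z.
have d_gt0 := dvdn_gt0 n_gt0 d_dvd.
have prim_zd : (n %/ d).-primitive_root (z ^+ d).
  by have := dvdn_prim_root prim_z (dvdn_div d_dvd); rewrite divnA // mulKn.
rewrite -big_filter (perm_big _ (perm_multiples_iota n d_gt0)) big_map.
under eq_bigr do rewrite exprM.
rewrite -(factor_Xn_sub_1 prim_zd) -(prednK (prim_order_gt0 prim_zd)).
rewrite big_nat_recr //= [RHS]big_nat_recl //= mulrC big_add1 /=.
by rewrite (prednK (prim_order_gt0 prim_zd)) (prim_expr_order prim_zd) expr0.
Qed.

Section RootOfUnity.
Variable R : realType.

Lemma de_moivre (x : R) j :
  Complex (cos x) (sin x) ^+ j = Complex (cos (x *+ j)) (sin (x *+ j)).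
Proof.
elim: j => [|j IHj]; first by rewrite mulr0n cos0 sin0 expr0.
by rewrite exprSr IHj mulrSr cosD sinD; congr Complex; rewrite addrC.
Qed.

Lemma cos_lt1 (x : R) : 0 < x < 2 * pi -> cos x < 1.
Proof.
move=> /andP[x_gt0 x_lt].
have -> : x = (x / 2) *+ 2 by rewrite -mulr_natr divfK // pnatr_eq0.
have s_gt0 : 0 < sin (x / 2) by apply: sin_gt0_pi; apply/andP; split; lra.
by rewrite cos_mulr2n cos2sin2; have := exprn_gt0 2 s_gt0; lra.
Qed.

Lemma zeta_prim_root n : (0 < n)%N -> n.-primitive_root (zeta R n).
Proof.
move=> n_gt0; have n_pos : 0 < n%:R :> R by rewrite ltr0n.
have pi2_gt0 : 0 < 2 * pi :> R by rewrite mulr_gt0 // pi_gt0.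
apply/andP; split=> //; apply/forallP => i; apply/eqP.
have angleE : 2 * pi / n%:R *+ i.+1 = 2 * pi * i.+1%:R / n%:R :> R.
  by rewrite -[LHS]mulr_natr mulrAC.
rewrite unity_rootE /zeta de_moivre angleE.
have [->|i_neq] := eqVneq i.+1 n.
  by rewrite (mulfK (lt0r_neq0 n_pos)) mulr_natl cos2pi sin2pi eqxx.
have i_lt : (i.+1 < n)%N by rewrite ltn_neqAle i_neq ltn_ord.
apply/negbTE/eqP => -[cos1 _].
suff : cos (2 * pi * i.+1%:R / n%:R) < 1 :> R by rewrite cos1 ltxx.
apply: cos_lt1; rewrite divr_gt0 ?mulr_gt0 ?pi_gt0 //=.
by rewrite ltr_pdivrMr // ltr_pM2l // ltr_nat.
Qed.

End RootOfUnity.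

Section BinomialSeries.
Variable F : numFieldType.
Implicit Types (e : int) (j : nat).

Lemma gbinom0r e : gbinom F e 0 = 1.
Proof. by rewrite /gbinom big_ord0 divr1. Qed.

Lemma gbinom0l j : gbinom F 0 j = (j == 0%N)%:R.
Proof.
case: j => [|j]; first exact: gbinom0r.
by rewrite /gbinom big_ord_recl subrr !mul0r.
Qed.

Lemma gbinomS e j : gbinom F (e + 1) j.+1 = gbinom F e j.+1 + gbinom F e j.
Proof.
rewrite /gbinom big_ord_recl big_ord_recr /= factS natrM.
have -> : \prod_(i < j) ((e + 1)%:~R - (lift ord0 i)%:R) =
    \prod_(i < j) (e%:~R - i%:R) :> F.
  by apply: eq_bigr => i _; rewrite lift0 intrD -natr1; ring.
rewrite intrD; field.
by rewrite nat1r !pnatr_eq0 -lt0n fact_gt0.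
Qed.

Variables (B : comUnitAlgType F) (x : B) (N : nat).
Hypothesis x_nilpotent : x ^+ N = 0.

Let binomial_sum e : B := \sum_(j < N) gbinom F e j *: x ^+ j.

Lemma binomial_sum0 : binomial_sum 0 = 1.
Proof.
rewrite /binomial_sum; case: N x_nilpotent => [/eqP|M _].
  by rewrite expr0 oner_eq0.
rewrite big_ord_recl gbinom0r expr0 scale1r big1 ?addr0 // => j _.
by rewrite gbinom0l scale0r.
Qed.

Lemma binomial_sumS e : binomial_sum e * (1 + x) = binomial_sum (e + 1).
Proof.
rewrite /binomial_sum; case: N x_nilpotent => [|M] xM.
  by rewrite !big_ord0 mul0r.
rewrite mulrDr mulr1 [in X in _ + X]big_ord_recr mulrDl mulr_suml /=.
rewrite -[in X in _ + (_ + X)]scalerAl -exprSr xM scaler0 addr0.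
rewrite !big_ord_recl !gbinom0r -addrA -big_split /=; congr (_ + _).
apply: eq_bigr => j _; rewrite /bump /= add1n gbinomS scalerDl.
by rewrite -scalerAl -exprSr.
Qed.

Lemma binomial_sumD e n :
  binomial_sum e * (1 + x) ^+ n = binomial_sum (e + n%:Z).
Proof.
elim: n => [|n IHn]; first by rewrite expr0 mulr1 addr0.
by rewrite exprSr mulrA IHn binomial_sumS -addrA intS [1 + _]addrC.
Qed.

Lemma binomial_series e : (1 + x) ^ e = \sum_(j < N) gbinom F e j *: x ^+ j.
Proof.
rewrite -/(binomial_sum e); case: e => n.
  by rewrite -[Posz n]add0r -binomial_sumD binomial_sum0 mul1r.
rewrite NegzE -exprnN; apply: mulr1_eq.
by rewrite mulrC binomial_sumD addNr binomial_sum0.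
Qed.

End BinomialSeries.

Lemma coef_prod_sum_Xn (R : comNzRingType) (I J : finType) (c : I -> J -> R)
    (w : I -> J -> nat) m :
  (\prod_i \sum_j c i j *: 'X^(w i j))`_m =
  \sum_(f : {ffun I -> J} | \sum_i w i (f i) == m) \prod_i c i (f i).
Proof.
rewrite bigA_distr_bigA /= coef_sum [RHS]big_mkcond; apply: eq_bigr => f _.
rewrite scaler_prod prodrXr coefZ coefXn eq_sym.
by case: eqP => _; rewrite ?mulr1 ?mulr0.
Qed.

Section Truncation.
Variable F : fieldType.
Implicit Types p q h : {poly F}.

Lemma unit_in_qpoly h p :
  (in_qpoly h p \is a GRing.unit) = coprimep (mk_monic h) p.
Proof.
by rewrite -[RHS]coprimep_modr Pdiv.IdomainMonic.modpE ?monic_mk_monic.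
Qed.

Lemma unit_in_qpolyXn N p :
  (in_qpoly 'X^N p \is a GRing.unit) = ~~ root p 0.
Proof.
by rewrite unit_in_qpoly mk_monic_Xn coprimep_pexpl // coprimep_sym coprimepX.
Qed.

Lemma in_qpolyXnE N p : (0 < N)%N ->
  in_qpoly 'X^N p = take_poly N p :> {poly F}.
Proof.
case: N => // N _.
by rewrite /= mk_monic_Xn Pdiv.RingMonic.take_poly_rmodp.
Qed.

Lemma qpolyX_nilpotent N : (0 < N)%N ->
  'qX ^+ N = 0 :> {poly %/ ('X^N : {poly F})}.
Proof.
move=> N_gt0; rewrite -rmorphXn; apply: val_inj.
by rewrite [LHS]in_qpolyXnE // -['X^N]mul1r take_polyMXn_0.
Qed.

Lemma eq_coef_in_qpolyXn N p q i : (i < N)%N ->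
  in_qpoly 'X^N p = in_qpoly 'X^N q -> p`_i = q`_i.
Proof.
move=> i_lt /(congr1 (fun r : {poly %/ 'X^N} => (r : {poly F})`_i)).
by rewrite !in_qpolyXnE ?(leq_ltn_trans _ i_lt) // !coef_take_poly i_lt.
Qed.

End Truncation.

Definition binomial_trunc (F : numFieldType) (N d : nat) (e : int) : {poly F} :=
  \sum_(j < N) ((-1) ^+ j * gbinom F e j) *: 'X^(d * j).

Lemma coef_prod_binomial_trunc (F : numFieldType) N k m (e : nat -> int) :
  (\prod_(d < k) binomial_trunc F N d.+1 (e d.+1))`_m =
  \sum_(j : {ffun 'I_k -> 'I_N} | (\sum_(d < k) d.+1 * j d)%N == m)
    \prod_(d < k) ((-1) ^+ j d * gbinom F (e d.+1) (j d)).
Proof.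
exact: (coef_prod_sum_Xn
  (fun (d : 'I_k) (j : 'I_N) => (-1) ^+ j * gbinom F (e d.+1) j)
  (fun d j => d.+1 * j)%N).
Qed.

Lemma in_qpoly_binomial_trunc (F : numFieldType) N d (e : int) :
  (0 < N)%N -> (0 < d)%N ->
  in_qpoly 'X^N (binomial_trunc F N d e) = (1 - 'qX ^+ d) ^ e.
Proof.
move=> N_gt0 d_gt0.
have nilp : (- 'qX ^+ d) ^+ N = 0 :> {poly %/ ('X^N : {poly F})}.
  by rewrite exprNn exprAC qpolyX_nilpotent // expr0n gtn_eqF // mulr0.
rewrite (binomial_series nilp) linear_sum; apply: eq_bigr => j _.
rewrite linearZZ rmorphXn exprM [in RHS](exprNn ('qX ^+ d)) mulrC -[LHS]scalerA.
by congr (_ *: _); rewrite -signr_odd scaler_sign -signr_odd mulr_sign.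
Qed.

Lemma in_qpoly_prod_binomial_trunc (F : numFieldType) N k (e : nat -> int) :
  (0 < N)%N ->
  in_qpoly 'X^N (\prod_(d < k) binomial_trunc F N d.+1 (e d.+1)) =
  \prod_(d < k) (1 - 'qX ^+ d.+1) ^ e d.+1.
Proof.
move=> N_gt0; rewrite rmorph_prod; apply: eq_bigr => d _.
exact: in_qpoly_binomial_trunc.
Qed.

Lemma big_regular_divisors_trunc (T : Type) (idx : T) (op : Monoid.com_law idx)
    (A : nat -> set nat) n k (G : nat -> T) :
  regular_system A -> (0 < n)%N -> (forall d, (k < d)%N -> G d = idx) ->
  \big[op/idx]_(d <- regular_divisors A n) G d =
  \big[op/idx]_(d < k | d.+1 \in A n) G d.+1.
Proof.
move=> hA n_gt0 G_idx.
rewrite -(big_mkord (fun d => d.+1 \in A n) (fun d => G d.+1)).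
rewrite -(big_add1 _ _ 0 k.+1 (fun d => d \in A n) G).
rewrite (bigID (fun d => d <= k)%N) /= [X in op _ X]big1; last first.
  by move=> d; rewrite -ltnNge => /G_idx.
rewrite Monoid.mulm1 -big_filter -[RHS]big_filter.
apply: perm_big; apply: uniq_perm.
- exact/filter_uniq/regular_divisors_uniq.
- exact/filter_uniq/iota_uniq.
move=> d; rewrite mem_filter mem_regular_divisors //.
rewrite [RHS]mem_filter mem_index_iota ltnS andbC.
apply: andb_id2l => /set_mem Ad.
by rewrite (regular_gt0 hA n_gt0 Ad).
Qed.

Lemma prod_mobiusAS_quo_nilpotent (B : comUnitRingType) (A : nat -> set nat)
    (S : set nat) n k (x : B) :
  regular_system A -> (0 < n)%N -> x ^+ k.+1 = 0 ->
  \prod_(d <- regular_divisors A n) (1 - x ^+ d) ^ mobiusAS A S (n %/ d) =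
  \prod_(d < k) (1 - x ^+ d.+1) ^ mobiusAS_quo A S n d.+1.
Proof.
move=> hA n_gt0 x_nilp.
rewrite (@big_regular_divisors_trunc _ _ _ A n k _ hA n_gt0) => [|d k_lt_d].
  rewrite big_mkcond; apply: eq_bigr => d _.
  by rewrite /mobiusAS_quo; case: ifP.
by rewrite -(subnKC k_lt_d) exprD x_nilp mul0r subr0 exp1rz.
Qed.

(* Applied to the embedding of polynomials into rational functions, this is
   the factorization of [PhiAS] into integer powers of the [1 - 'X^d]. *)
Lemma rmorph_PhiAS (R : realType) (A : nat -> set nat) (S : set nat) n
    (B : comUnitRingType) (f : {rmorphism {poly R[i]} -> B}) :
  regular_system A -> (0 < n)%N ->
  (forall j, f ('X - (zeta R n ^+ j)%:P) \is a GRing.unit) ->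
  f (PhiAS R A S n) = (-1) ^+ (n \in S) *
    \prod_(d <- regular_divisors A n) (1 - f 'X ^+ d) ^ mobiusAS A S (n %/ d).
Proof.
move=> hA n_gt0 f_unit; pose y m := 1 - f 'X ^+ m.
have f_multiples d : A n d ->
    \prod_(1 <= j < n.+1 | (d %| j)%N) f ('X - (zeta R n ^+ j)%:P) =
    -1 * y (n %/ d)%N.
  move=> /(regular_dvd hA n_gt0) d_dvd; rewrite -rmorph_prod.
  rewrite (factor_Xn_sub_1_multiples (zeta_prim_root R n_gt0) d_dvd).
  by rewrite rmorphB rmorph1 rmorphXn mulN1r opprB.
have y_unit d : A n d -> y (n %/ d)%N \is a GRing.unit.
  by move=> Ad; rewrite -unitrN -mulN1r -f_multiples // rpred_prod.
transitivity (\prod_(d <- regular_divisors A n)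
    ((-1) ^ mobiusAS A S d * y (n %/ d)%N ^ mobiusAS A S d)).
  rewrite rmorph_prod (prod_gcdA _ _ Posz hA n_gt0 f_unit).
  apply: eq_big_seq => d /(regular_divisorsP hA n_gt0) Ad.
  by rewrite f_multiples // exprMz_comm ?unitrN1 ?y_unit //; apply: mulrC.
rewrite big_split /= prodr_exprz_sum ?unitrN1 // sum_mobiusAS // /rho natz.
rewrite -exprnP; congr (_ * _).
rewrite (perm_big _ (perm_regular_divisors_divn hA n_gt0)) big_map.
apply: eq_big_seq => d /(regular_divisorsP hA n_gt0) Ad.
by rewrite divnA ?(regular_dvd hA) // mulKn.
Qed.

(* The bound j_d <= k excludes no solution of j_1 + 2 j_2 + ... + k j_k = k. *)
Theorem theorem11 (R : realType) (A : nat -> set nat) (S : set nat) (n : nat)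
    (hA : regular_system A)
    (hS_pos : S `<=` [set m | (0 < m)%N]) (hS_ne : S !=set0)
    (hn : (0 < n)%N) (k : nat) (hk : (0 < k)%N) :
  (PhiAS R A S n)`_k =
  (-1) ^+ (n \in S) *
  \sum_(j : {ffun 'I_k -> 'I_k.+1} | (\sum_(d < k) d.+1 * j d)%N == k)
    \prod_(d < k)
      ((-1) ^+ (j d) * gbinom R[i] (mobiusAS_quo A S n d.+1) (j d)).
Proof.
have root_unit j :
    in_qpoly 'X^(k.+1) ('X - (zeta R n ^+ j)%:P) \is a GRing.unit.
  rewrite unit_in_qpolyXn root_XsubC eq_sym expf_eq0 negb_and.
  by rewrite (prim_root_eq0 (zeta_prim_root R hn)) gtn_eqF ?orbT.
rewrite -(coef_prod_binomial_trunc _ _ _ _ (mobiusAS_quo A S n)) -coefZ.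
apply: (eq_coef_in_qpolyXn (ltnSn k)).
rewrite (rmorph_PhiAS S hA hn root_unit) in_qpolyZ scaler_sign mulr_sign.
have x_nilp := qpolyX_nilpotent R[i] (ltn0Sn k).
rewrite in_qpoly_prod_binomial_trunc //.
by rewrite (prod_mobiusAS_quo_nilpotent S hA hn x_nilp).
Qed.
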